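(* Let $0<\varepsilon<1$, let $n\ge1$ and $k\ge1$ be integers, and let $A=(a_{pq})$ be a real $n\times n$ matrix with $a_{11}>0$. Suppose $\lambda>0$ is a simple eigenvalue of $A$ with $A\mathbf u=\lambda\mathbf u$ and $\mathbf v^TA=\lambda\mathbf v^T$ for some entrywise positive $\mathbf u,\mathbf v\in\mathbb R^n$. In each part below $B=(b_{pq})$ is a real matrix of order $k+n-1$, and in all parts $w_i=u_1$ for $1\le i\le k-1$ and $w_i=u_{i-k+1}$ for $k\le i\le k+n-1$. Then: 1. For every $j\in\{1,\dots,k\}$, let $$b_{pq}=\begin{cases} \lambda,&\text{if }(p,q)\in\{(1,2),\dots,(k-1,k)\};\\ a_{11},&\text{if }(p,q)=(k,1);\\ a_{p-k+1,1},&\text{if }p\in\{k+1,\dots,k+n-1\},\ q=j;\\ a_{p-k+1,q-k+1},&\text{if }p\in\{k,\dots,k+n-1\},\ q\in\{k+1,\dots,k+n-1\};\\ 0,&\text{otherwise}. \end{cases}$$ Then $\lambda$ is a simple eigenvalue of $B$, $B\mathbf w=\lambda\mathbf w$ and $\mathbf z^TB=\lambda\mathbf z^T$ where $z_i=\frac{a_{11}v_1}{\lambda}$ for $1\le i\le j-1$, $z_i=v_1$ for $j\le i\le k-1$, $z_i=v_{i-k+1}$ for $k\le i\le k+n-1$; consequently $B$ is algebraically positive. 2. For every $j\in\{1,\dots,k-1\}$ and $s\in\{1,\dots,k\}\setminus\{j+1\}$, let $$b_{pq}=\begin{cases} \varepsilon\lambda,&\text{if }(p,q)=(j,j+1);\\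 \lambda,&\text{if }(p,q)\in\{(1,2),\dots,(k-1,k)\}\setminus\{(j,j+1)\};\\ a_{11},&\text{if }(p,q)=(k,1);\\ (1-\varepsilon)\lambda,&\text{if }(p,q)=(j,s);\\ a_{p-k+1,1},&\text{if }p\in\{k+1,\dots,k+n-1\},\ q=s;\\ a_{p-k+1,q-k+1},&\text{if }p\in\{k,\dots,k+n-1\},\ q\in\{k+1,\dots,k+n-1\};\\ 0,&\text{otherwise}. \end{cases}$$ Then $\lambda$ is a simple eigenvalue of $B$ with $B\mathbf w=\lambda\mathbf w$ and $\mathbf z^TB=\lambda\mathbf z^T$, and $B$ is algebraically positive, where: if $s\le j$, $z_i=\frac{a_{11}v_1}{\lambda}$ for $1\le i\le s-1$, $z_i=\frac{v_1}{\varepsilon}$ for $s\le i\le j$, $z_i=v_1$ for $j+1\le i\le k-1$, $z_i=v_{i-k+1}$ for $k\le i\le k+n-1$; if $s\ge j+2$, $z_i=\frac{a_{11}v_1}{\lambda}$ for $1\le i\le j$, $z_i=\frac{\varepsilon a_{11}v_1}{\lambda}$ for $j+1\le i\le s-1$, $z_i=v_1$ for $s\le i\le k-1$, $z_i=v_{i-k+1}$ for $k\le i\le k+n-1$. Further, $b_{js}z_j+\sum_{i=1}^{n-1}b_{k+i,s}z_{k+i}$ equals $\left(\frac{\lambda}{\varepsilon}-a_{11}\right)v_1$ if $s\le j$ and equals $(\lambda-\varepsilon a_{11})v_1$ if $s\ge j+2$, and this quantity is positive for a suitable choice of $\varepsilon\in(0,1)$. 3. For every $s\in\{2,\dots,k\}$,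 let $$b_{pq}=\begin{cases} \lambda,&\text{if }(p,q)\in\{(1,2),\dots,(k-1,k)\};\\ \varepsilon a_{11},&\text{if }(p,q)=(k,1);\\ (1-\varepsilon)a_{11},&\text{if }(p,q)=(k,s);\\ a_{p-k+1,1},&\text{if }p\in\{k+1,\dots,k+n-1\},\ q=s;\\ a_{p-k+1,q-k+1},&\text{if }p\in\{k,\dots,k+n-1\},\ q\in\{k+1,\dots,k+n-1\};\\ 0,&\text{otherwise}. \end{cases}$$ Then $\lambda$ is a simple eigenvalue of $B$, $B\mathbf w=\lambda\mathbf w$ and $\mathbf z^TB=\lambda\mathbf z^T$ where $z_i=\frac{\varepsilon a_{11}v_1}{\lambda}$ for $1\le i\le s-1$, $z_i=v_1$ for $s\le i\le k-1$, $z_i=v_{i-k+1}$ for $k\le i\le k+n-1$; consequently $B$ is algebraically positive. Further, $b_{ks}z_k+\sum_{i=1}^{n-1}b_{k+i,s}z_{k+i}=(\lambda-\varepsilon a_{11})v_1$, and this is positive for a suitable choice of $\varepsilon\in(0,1)$.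
   Context: A real square matrix $M$ is algebraically positive if there is a real polynomial $f$ such that every entry of $f(M)$ is positive. A simple eigenvalue is one of algebraic multiplicity one. Index ranges of the form $a\le i\le b$ with $a>b$ are empty. *)

(* Defs.v *)
From mathcomp Require Import all_boot all_order all_algebra.
From mathcomp Require Export reals.
Set Implicit Arguments.
Unset Strict Implicit.
Unset Printing Implicit Defensive.
Import Order.TTheory GRing.Theory Num.Theory.
Local Open Scope ring_scope.

Section Defs.
Variable R : realType.

Definition poly_at_mx (m : nat) (M : 'M[R]_m) (f : {poly R}) : 'M[R]_m :=
  \sum_(i < size f) f`_i *: iter i (mulmx M) 1%:M.

Definition alg_positive (m : nat) (M : 'M[R]_m) : Prop :=
  exists f : {poly R}, forall i j, 0 < (poly_at_mx M f) i j.

Definition simple_eigenvalue (m : nat) (M : 'M[R]_m) (l : R) : Prop :=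
  mup l (char_poly M) = 1%N.

(* 1-based entry access (0 outside the index range) *)
Definition ent (m m' : nat) (M : 'M[R]_(m, m')) (p q : nat) : R :=
  if (p == 0%N) || (q == 0%N) then 0 else
  match (insub p.-1 : option 'I_m), (insub q.-1 : option 'I_m') with
  | Some i, Some j => M i j
  | _, _ => 0
  end.

Definition mkmx (N : nat) (f : nat -> nat -> R) : 'M[R]_N :=
  \matrix_(p < N, q < N) f p.+1 q.+1.
Definition mkcol (N : nat) (f : nat -> R) : 'cV[R]_N :=
  \col_(i < N) f i.+1.

Variables (n k : nat) (A : 'M[R]_n) (lam : R) (u v : 'cV[R]_n).

Local Notation a := (ent A).
Local Notation uu i := (ent u i 1).
Local Notation vv i := (ent v i 1).
Local Notation N := (k + n - 1)%N.

Definition blockA (p q : nat) : R :=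
  if [&& (k <= p)%N, (p <= k + n - 1)%N, (k + 1 <= q)%N & (q <= k + n - 1)%N]
  then a (p - k + 1) (q - k + 1) else 0.

Definition superdiag (p q : nat) : bool := [&& (1 <= p)%N, (p < k)%N & q == p.+1].

Definition B1f (j : nat) (p q : nat) : R :=
  if superdiag p q then lam
  else if (p == k) && (q == 1%N) then a 1 1
  else if [&& (k + 1 <= p)%N, (p <= k + n - 1)%N & q == j] then a (p - k + 1) 1
  else blockA p q.
Definition B1 (j : nat) : 'M[R]_N := mkmx N (B1f j).

Definition B2f (e : R) (j s : nat) (p q : nat) : R :=
  if (p == j) && (q == j.+1) then e * lam
  else if superdiag p q then lam
  else if (p == k) && (q == 1%N) then a 1 1
  else if (p == j) && (q == s) then (1 - e) * lam
  else if [&& (k + 1 <= p)%N, (p <= k + n - 1)%N & q == s] then a (p - k + 1) 1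
  else blockA p q.
Definition B2 (e : R) (j s : nat) : 'M[R]_N := mkmx N (B2f e j s).

Definition B3f (e : R) (s : nat) (p q : nat) : R :=
  if superdiag p q then lam
  else if (p == k) && (q == 1%N) then e * a 1 1
  else if (p == k) && (q == s) then (1 - e) * a 1 1
  else if [&& (k + 1 <= p)%N, (p <= k + n - 1)%N & q == s] then a (p - k + 1) 1
  else blockA p q.
Definition B3 (e : R) (s : nat) : 'M[R]_N := mkmx N (B3f e s).

Definition wvec : 'cV[R]_N :=
  mkcol N (fun i => if (i <= k - 1)%N then uu 1 else uu (i - k + 1)).

Definition z1 (j : nat) : 'cV[R]_N :=
  mkcol N (fun i =>
    if (i <= j - 1)%N then a 1 1 * vv 1 / lam
    else if (i <= k - 1)%N then vv 1
    else vv (i - k + 1)).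

Definition z2 (e : R) (j s : nat) : 'cV[R]_N :=
  mkcol N (fun i =>
    if (s <= j)%N then
      (if (i <= s - 1)%N then a 1 1 * vv 1 / lam
       else if (i <= j)%N then vv 1 / e
       else if (i <= k - 1)%N then vv 1
       else vv (i - k + 1))
    else
      (if (i <= j)%N then a 1 1 * vv 1 / lam
       else if (i <= s - 1)%N then e * a 1 1 * vv 1 / lam
       else if (i <= k - 1)%N then vv 1
       else vv (i - k + 1))).

Definition z3 (e : R) (s : nat) : 'cV[R]_N :=
  mkcol N (fun i =>
    if (i <= s - 1)%N then e * a 1 1 * vv 1 / lam
    else if (i <= k - 1)%N then vv 1
    else vv (i - k + 1)).

Definition colquant (B : 'M[R]_N) (z : 'cV[R]_N) (p0 s : nat) : R :=
  ent B p0 s * ent z p0 1 + \sum_(1 <= i < n) ent B (k + i) s * ent z (k + i) 1.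

End Defs.

(* Main.v *)
Require Import Defs.
From mathcomp Require Import all_boot all_order all_algebra.
From mathcomp Require Import reals.
From mathcomp Require Import zify ring lra.
Import Order.TTheory GRing.Theory Num.Theory.
Local Open Scope ring_scope.

(* If A u = lam u, v^T A = lam v^T and v^T u <> 0, comparing determinants in
     (X - A) ((X - lam) I - u v^T) = (X - lam) (X - (A + u v^T))
   shows that lam is a simple eigenvalue iff it is not an eigenvalue of
   A + u v^T, that is, iff the lam-eigenspace of A is the line spanned by u.
   All three matrices B have the same shape: a weighted cycle
   1 -> 2 -> ... -> k -> 1 in which an amount d of the weight leaving j is
   redirected to s, the rest of the first column of A being moved to column s.
   The first k - 1 rows force a lam-eigenvector of B to be constant on its first
   k entries, hence to come from a lam-eigenvector of A, so simplicity passes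
   from A to B.  Finally, if lam is simple with positive eigenvectors w and z and
   q is the characteristic polynomial divided by X - lam, then q(B) / q(lam) is
   the spectral projection w z^T / (z^T w), which is positive. *)

(** * Rank-one updates and algebraic simplicity *)

(** The bordered matrix [M] is reduced by blocks in two ways, one for each Schur complement. The
    factor y avoids inverting y, so that y may be the polynomial X - lam. *)
Lemma det_scalar_sub_rank1 (S : comNzRingType) (n : nat) (y : S)
    (U V : 'cV[S]_n) :
  y * \det (y%:M - U *m V^T) = y ^+ n * (y - (V^T *m U) 0 0).
Proof.
pose M := block_mx y%:M U V^T (1%:M : 'M_1).
have dM : \det M = \det (y%:M - U *m V^T).
  have -> : M = block_mx 1%:M U 0 1%:M *m block_mx (y%:M - U *m V^T) 0 V^T 1%:M.
    by rewrite mulmx_block !mul1mx !mul0mx !mulmx1 !add0r subrK.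
  by rewrite det_mulmx det_ublock det_lblock !det1 !mulr1 mul1r.
rewrite -dM.
have -> : y * \det M = \det (block_mx 1%:M 0 (- V^T) y%:M *m M).
  by rewrite det_mulmx det_lblock det1 det_scalar1 mul1r.
rewrite mulmx_block !mul1mx !mul0mx !addr0 mulmx1 !mulNmx.
rewrite scalar_mxC addNr det_ublock det_scalar; congr (_ * _).
by rewrite det_mx11 !mxE eqxx mulr1n addrC.
Qed.

(** Brauer's theorem in polynomial form: the update along an eigenvector moves one root lam to lam +
    v^T u and keeps the others. *)
Lemma char_poly_add_rank1 (F : fieldType) (n : nat) (A : 'M[F]_n) (lam : F)
    (u v : 'cV[F]_n) :
  A *m u = lam *: u ->
  char_poly A * ('X - (lam + (v^T *m u) 0 0)%:P)
    = ('X - lam%:P) * char_poly (A + u *m v^T).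
Proof.
move=> Au; set e := (v^T *m u) 0 0; set y := 'X - lam%:P.
pose U := map_mx polyC u; pose V := map_mx polyC v.
have VU : (V^T *m U) 0 0 = e%:P by rewrite /V map_trmx -map_mxM mxE.
have prodE : char_poly_mx A *m (y%:M - U *m V^T)
    = y *: char_poly_mx (A + u *m v^T).
  rewrite mulmxBr mul_mx_scalar mulmxA.
  have -> : char_poly_mx A *m U = y *: U.
    rewrite /char_poly_mx mulmxBl mul_scalar_mx -map_mxM Au.
    by rewrite map_mxZ -scalerBl.
  rewrite -scalemxAl -scalerBr /char_poly_mx map_mxD map_mxM -map_trmx.
  by rewrite opprD addrA.
have y0 : y ^+ n != 0 by rewrite expf_neq0 ?polyXsubC_eq0.
apply: (mulfI y0).
have := congr1 (fun M => y * \det M) prodE.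
rewrite det_mulmx detZ mulrCA det_scalar_sub_rank1 VU => H.
rewrite polyCD opprD addrA -/y /char_poly mulrCA H.
by rewrite mulrCA.
Qed.

(** The condition v^T u != 0 separates the line of u from the kernel of v^T, and on that kernel A
    and A + u v^T agree. *)
Lemma simple_eigenvalueP (R : realType) (n : nat) (A : 'M[R]_n) (lam : R)
    (u v : 'cV[R]_n) :
  A *m u = lam *: u -> v^T *m A = lam *: v^T -> (v^T *m u) 0 0 != 0 ->
  simple_eigenvalue A lam <->
    (forall x : 'cV_n, A *m x = lam *: x -> exists c, x = c *: u).
Proof.
move=> Au vA e0; set e := (v^T *m u) 0 0 in e0 *.
(* Since e != 0, the factor X - (lam + e) does not vanish at lam, so the update lowers the
   multiplicity of lam by exactly one. *)
have mupE : mup lam (char_poly A)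
    = (1 + mup lam (char_poly (A + u *m v^T)))%N.
  have Xlam : ~~ root ('X - (lam + e)%:P) lam.
    by rewrite root_XsubC eq_sym addrC -subr_eq0 addrK.
  rewrite -(mupMl _ Xlam) (char_poly_add_rank1 _ _ _ _ _ _ Au).
  rewrite mupM ?polyXsubC_eq0 ?monic_neq0 ?char_poly_monic //.
  by rewrite -['X - _]expr1 mup_XsubCX eqxx.
set C := A + _ in mupE.
have -> : simple_eigenvalue A lam <-> ~~ root (char_poly C) lam.
  rewrite /simple_eigenvalue mupE; split=> [[/eqP]|/mupNroot ->] //.
  by rewrite -dvdp_XsubCl XsubC_dvd ?monic_neq0 ?char_poly_monic // lt0n negbK.
have Cv (x : 'cV_n) : C *m x = lam *: x -> v^T *m x = 0 /\ A *m x = lam *: x.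
  move=> Cx; have vx0 : v^T *m x = 0.
    have := congr1 (mulmx v^T) Cx.
    rewrite mulmxDl mulmxDr !mulmxA vA -scalemxAl -scalemxAr -[RHS]addr0.
    move/addrI; rewrite [v^T *m u]mx11_scalar mul_scalar_mx -scalemxAl.
    by move/eqP; rewrite scaler_eq0 (negPf e0) => /eqP.
  by split=> //; rewrite -Cx mulmxDl -mulmxA vx0 mulmx0 addr0.
have rootE : root (char_poly C) lam = (\det (lam%:M - C) == 0).
  rewrite -eigenvalue_root_char.
  apply/eigenvalueP/det0P=> [[x Cx x0] | [x x0 Cx]]; exists x => //.
    by rewrite mulmxBr Cx mul_mx_scalar subrr.
  by apply/eqP; rewrite -mul_mx_scalar eq_sym -subr_eq0 -mulmxBr Cx.
rewrite rootE; split=> [dC x Ax | H].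
  (* This scalar makes v^T kill t = x - c u. Then t lies in the kernel of lam - C, which is
     invertible here. *)
  exists ((v^T *m x) 0 0 / e); apply/eqP; rewrite -subr_eq0.
  set t := x - _; have vt : v^T *m t = 0.
    rewrite mulmxBr -scalemxAr [v^T *m x]mx11_scalar [v^T *m u]mx11_scalar.
    by rewrite scale_scalar_mx [in X in _ - X]mxE eqxx mulr1n divfK ?subrr.
  have At : A *m t = lam *: t.
    by rewrite mulmxBr -scalemxAr Ax Au scalerBr !scalerA mulrC.
  have Ct : (lam%:M - C) *m t = 0.
    by rewrite mulmxBl mul_scalar_mx mulmxDl At -mulmxA vt mulmx0 addr0 subrr.
  have Cu : lam%:M - C \in unitmx by rewrite unitmxE unitfE.
  by rewrite -(mulKmx Cu t) Ct mulmx0.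
(* [det0P] yields a row vector, so the determinant is transposed first to obtain a column in the
   kernel of lam - C. By [H] that column is c u, and v^T (c u) = 0 forces c = 0. *)
rewrite -det_tr; apply/negP=> /det0P [x x0 xC].
have /Cv [vx Ax] : C *m x^T = lam *: x^T.
  apply/eqP; rewrite eq_sym -subr_eq0 -mul_scalar_mx -mulmxBl.
  by rewrite -[_ - _]trmxK -trmx_mul xC trmx0.
have [c xE] := H _ Ax; move: vx; rewrite xE -scalemxAr.
move/matrixP/(_ 0 0); rewrite mxE [RHS]mxE -/e => /eqP.
rewrite mulf_eq0 (negPf e0) orbF => /eqP c0.
by move: x0; rewrite -[x]trmxK xE c0 scale0r trmx0 eqxx.
Qed.

(** * From positive eigenvectors to a positive polynomial in the matrix *)

Lemma dotmx_gt0 (R : realType) (n : nat) (u v : 'cV[R]_n) :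
  (0 < n)%N -> (forall i, 0 < u i 0) -> (forall i, 0 < v i 0) ->
  0 < (v^T *m u) 0 0.
Proof.
case: n u v => // n u v _ u0 v0; rewrite mxE big_ord_recl ltr_pwDl //.
  by rewrite mxE mulr_gt0.
by apply: sumr_ge0 => i _; rewrite mxE mulr_ge0 // ltW.
Qed.

Lemma poly_at_mxE (R : realType) (m : nat) (M : 'M[R]_m.+1) (f : {poly R}) :
  poly_at_mx M f = horner_mx M f.
Proof.
rewrite /poly_at_mx -[f in RHS]coefK poly_def raddf_sum /=.
apply: eq_bigr => i _; rewrite linearZ rmorphXn /= horner_mx_X; congr (_ *: _).
by elim: (nat_of_ord i) => [|k IH]; rewrite ?expr0 // iterS IH exprS.
Qed.

(* If char_poly M = q * ('X - lam), the columns of q(M) are eigenvectors for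
   lam, so q(M) is a multiple of w *m z^T, nonzero as q(lam) != 0. *)
Lemma alg_positive_simple (R : realType) (m : nat) (M : 'M[R]_m) (lam : R)
    (w z : 'cV[R]_m) :
  simple_eigenvalue M lam -> M *m w = lam *: w -> z^T *m M = lam *: z^T ->
  (forall i, 0 < w i 0) -> (forall i, 0 < z i 0) -> alg_positive M.
Proof.
case: m M w z => [|m] M w z simM Mw zM w0 z0; first by exists 0 => -[].
have zw0 : 0 < (z^T *m w) 0 0 by apply: dotmx_gt0.
have ker := (simple_eigenvalueP _ _ _ _ _ _ Mw zM (lt0r_neq0 zw0)).1 simM.
have cM0 : char_poly M != 0 by rewrite monic_neq0 ?char_poly_monic.
have : 'X - lam%:P %| char_poly M by rewrite XsubC_dvd // simM.
move=> /dvdpP [q qE].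
have q0 : q != 0 by apply: contraNneq cM0 => q0; rewrite qE q0 mul0r.
have ql : q.[lam] != 0.
  move: simM; rewrite /simple_eigenvalue qE mupM ?polyXsubC_eq0 //.
  rewrite -['X - _]expr1 mup_XsubCX eqxx addn1 => -[/eqP].
  by rewrite -[_ == _]negbK -lt0n -XsubC_dvd // dvdp_XsubCl.
have zp (p : {poly R}) : z^T *m horner_mx M p = p.[lam] *: z^T.
  elim/poly_ind: p => [|p c IH]; first by rewrite rmorph0 horner0 scale0r mulmx0.
  rewrite !hornerE rmorphD rmorphM /= horner_mx_X horner_mx_C mulmxDr.
  by rewrite -mulmxE mulmxA IH -scalemxAl zM scalerA mul_mx_scalar -scalerDl.
(* The normalisation f(lam) = 1 gives z^T f(M) = z^T. Entry j of this equation reads c (z^T w) =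
   z_j, hence c > 0 for the scalar of column j. *)
pose f := q.[lam]^-1 *: q; exists f => i j; rewrite poly_at_mxE.
have zf : z^T *m horner_mx M f = z^T by rewrite zp hornerZ mulVf ?scale1r.
have Mf : M *m horner_mx M f = lam *: horner_mx M f.
  apply/eqP; rewrite -subr_eq0 -mul_scalar_mx -mulmxBl.
  have -> : M - lam%:M = horner_mx M ('X - lam%:P).
    by rewrite rmorphB /= horner_mx_X horner_mx_C.
  rewrite mulmxE -rmorphM /= mulrC /f -scalerAl -qE linearZ /=.
  by rewrite Cayley_Hamilton scaler0.
have [c cE] : exists c, col j (horner_mx M f) = c *: w.
  by apply: ker; rewrite colE mulmxA Mf -scalemxAl.
have := congr1 (fun x : 'rV_m.+1 => x 0 j) zf.
have -> : (z^T *m horner_mx M f) 0 j = c * (z^T *m w) 0 0.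
  have -> : c * (z^T *m w) 0 0 = (z^T *m col j (horner_mx M f)) 0 0.
    by rewrite cE -scalemxAr [RHS]mxE.
  by rewrite colE mulmxA -colE [RHS]mxE.
rewrite [_^T _ _]mxE => cz.
have c0 : 0 < c by rewrite -(pmulr_lgt0 _ zw0) cz.
by move/matrixP/(_ i 0): cE; rewrite !mxE => ->; rewrite mulr_gt0.
Qed.

(** * Matrices and vectors as functions of indices counted from 1 *)

Section NatIndexed.
Variable R : realType.

Lemma ent_mkmx (N : nat) (f : nat -> nat -> R) (p q : nat) :
  (0 < p <= N)%N -> (0 < q <= N)%N -> ent (mkmx N f) p q = f p q.
Proof.
case: p q => // p [|q] //= pN qN; rewrite /ent /=.
by rewrite (insubT (fun i => i < N)%N pN) (insubT (fun i => i < N)%N qN) mxE.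
Qed.

Lemma ent_mkcol (N : nat) (f : nat -> R) (p : nat) :
  (0 < p <= N)%N -> ent (mkcol N f) p 1 = f p.
Proof.
case: p => // p pN; rewrite /ent /=.
rewrite (insubT (fun i => i < N)%N pN) (insubT (fun i => i < 1)%N (ltn0Sn 0)).
by rewrite mxE.
Qed.

Lemma mkmx_ent (n : nat) (A : 'M[R]_n) : mkmx n (ent A) = A.
Proof. by apply/matrixP=> i j; rewrite mxE /ent /= !valK. Qed.

Lemma mkcol_ent (n : nat) (x : 'cV[R]_n) : mkcol n (fun i => ent x i 1) = x.
Proof.
apply/colP=> i; rewrite mxE /ent /= valK.
by rewrite (insubT (fun i => i < 1)%N (ltn0Sn 0)); congr (x _ _); apply: val_inj.
Qed.

Lemma mkmxP (N : nat) (f g : nat -> nat -> R) :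
  (forall p q, (0 < p <= N)%N -> (0 < q <= N)%N -> f p q = g p q) ->
  mkmx N f = mkmx N g.
Proof. by move=> fg; apply/matrixP=> i j; rewrite !mxE fg /=. Qed.

Lemma mkcolP (N : nat) (f g : nat -> R) :
  mkcol N f = mkcol N g <-> (forall p, (0 < p <= N)%N -> f p = g p).
Proof.
split=> [fg p pN | fg]; last by apply/colP=> i; rewrite !mxE fg /=.
by rewrite -(ent_mkcol _ f _ pN) fg ent_mkcol.
Qed.

Lemma scale_mkcol (N : nat) (c : R) (f : nat -> R) :
  c *: mkcol N f = mkcol N (fun i => c * f i).
Proof. by apply/colP=> i; rewrite !mxE. Qed.

Lemma mul_mkmx_mkcol (N : nat) (g : nat -> nat -> R) (x : nat -> R) :
  mkmx N g *m mkcol N x = mkcol N (fun p => \sum_(1 <= q < N.+1) g p q * x q).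
Proof.
apply/colP=> i; rewrite !mxE big_add1 /= big_mkord.
by apply: eq_bigr => q _; rewrite !mxE.
Qed.

Lemma mul_mkcol_mkmx (N : nat) (g : nat -> nat -> R) (z : nat -> R) :
  (mkcol N z)^T *m mkmx N g
    = (mkcol N (fun q => \sum_(1 <= p < N.+1) z p * g p q))^T.
Proof.
apply/rowP=> i; rewrite !mxE big_add1 /= big_mkord.
by apply: eq_bigr => q _; rewrite !mxE.
Qed.

(** Read from right to left, it spreads a single term into a delta sum, so that cycle and redirected
    terms can be merged index by index even where they meet. *)
Lemma sum_nat_pick (m n r : nat) (f : nat -> R) : (m <= r < n)%N ->
  \sum_(m <= q < n) (q == r)%:R * f q = f r.
Proof.
move=> rmn; rewrite (bigD1_seq r) ?iota_uniq ?mem_index_iota //= eqxx mul1r.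
by rewrite big1 ?addr0 // => q /negPf ->; rewrite mul0r.
Qed.

End NatIndexed.

(** * The cycle extension: its row and column sums *)

Section Extension.
Variables (R : realType) (n k : nat) (a : nat -> nat -> R) (lam : R).
Variables (j s : nat) (d : R).
Hypotheses (n1 : (0 < n)%N) (k1 : (0 < k)%N).
Hypotheses (jk : (0 < j <= k)%N) (sk : (0 < s <= k)%N).
Local Notation N := (k + n - 1)%N.

Definition cyc_next (p : nat) : nat := if (p < k)%N then p.+1 else 1%N.
Definition cyc_prev (q : nat) : nat := if q == 1%N then k else q.-1.

(** The weight left on the cycle edge out of p; the amount d taken away at j reappears in column s
    of [ext_entry]. *)
Definition cyc_weight (p : nat) : R :=
  (if (p < k)%N then lam else a 1 1) - d * (p == j)%:R.

(* B1 is the case d = 0, with s the column called j there; B2 is the case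
   d = (1 - eps) * lam; B3 is the case j = k, d = (1 - eps) * a 1 1. *)
Definition ext_entry (p q : nat) : R :=
  if (q <= k)%N then
    if (p <= k)%N then
      (q == cyc_next p)%:R * cyc_weight p + (q == s)%:R * (d * (p == j)%:R)
    else (q == s)%:R * a (p - k + 1) 1
  else if (k <= p)%N then a (p - k + 1) (q - k + 1) else 0.


(** Index i of the original matrix sits at position k + i - 1. Position k thus carries index 1 and
    is counted in the head, so the tail starts at i = 2. *)
Lemma sum_split_block (f : nat -> R) :
  \sum_(1 <= q < N.+1) f q
    = \sum_(1 <= q < k.+1) f q + \sum_(2 <= i < n.+1) f (k + i - 1)%N.
Proof.
rewrite (@big_cat_nat _ _ _ k.+1) /=; [|lia|lia]; congr (_ + _).
rewrite (_ : k.+1 = (2 + (k - 1))%N); last lia.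
rewrite big_addn (_ : (N.+1 - (k - 1) = n.+1)%N); last lia.
by apply: eq_bigr => i _; congr f; lia.
Qed.

Lemma ext_row_head (p : nat) (x : nat -> R) : (0 < p <= k)%N ->
  \sum_(1 <= q < N.+1) ext_entry p q * x q
    = cyc_weight p * x (cyc_next p) + d * (p == j)%:R * x s
      + (p == k)%:R * \sum_(2 <= i < n.+1) a 1 i * x (k + i - 1)%N.
Proof.
move=> pk; rewrite sum_split_block; congr (_ + _).
  rewrite -(@sum_nat_pick _ 1 k.+1 (cyc_next p) (fun q => cyc_weight p * x q)).
    rewrite -(@sum_nat_pick _ 1 k.+1 s (fun q => d * (p == j)%:R * x q)) //.
    rewrite -big_split /=; apply: eq_big_nat => q qk.
    by rewrite /ext_entry !ifT; [ring|lia|lia].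
  by rewrite /cyc_next; case: ifP; lia.
rewrite big_distrr /=; apply: eq_big_nat => i i2; rewrite /ext_entry ifF; last lia.
case: eqP => [->|pk']; first by rewrite leqnn mul1r; congr (a _ _ * _); lia.
by rewrite ifF ?mul0r //; lia.
Qed.

Lemma ext_row_tail (m : nat) (x : nat -> R) : (1 < m <= n)%N ->
  \sum_(1 <= q < N.+1) ext_entry (k + m - 1) q * x q
    = a m 1 * x s + \sum_(2 <= i < n.+1) a m i * x (k + i - 1)%N.
Proof.
move=> mn; rewrite sum_split_block; congr (_ + _).
  rewrite -(@sum_nat_pick _ 1 k.+1 s (fun q => a m 1 * x q)) //.
  apply: eq_big_nat => q qk; rewrite /ext_entry ifT ?ifF; [|lia|lia].
  by rewrite mulrA (_ : (k + m - 1 - k + 1 = m)%N) //; lia.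
apply: eq_big_nat => i i2; rewrite /ext_entry ifF ?ifT; [|lia|lia].
by congr (a _ _ * _); lia.
Qed.

Lemma ext_col_head (q : nat) (z : nat -> R) : (0 < q <= k)%N ->
  \sum_(1 <= p < N.+1) z p * ext_entry p q
    = z (cyc_prev q) * cyc_weight (cyc_prev q)
      + (q == s)%:R * (z j * d + \sum_(2 <= i < n.+1) z (k + i - 1)%N * a i 1).
Proof.
move=> qk; rewrite sum_split_block [_%:R * (_ + _)]mulrDr addrA; congr (_ + _).
  rewrite -(@sum_nat_pick _ 1 k.+1 (cyc_prev q) (fun p => z p * cyc_weight p)).
    rewrite -(@sum_nat_pick _ 1 k.+1 j (fun p => (q == s)%:R * (z p * d))) //.
    rewrite -big_split /=; apply: eq_big_nat => p pk.
    rewrite /ext_entry !ifT; [|lia|lia].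
    rewrite (_ : (q == cyc_next p) = (p == cyc_prev q)); first by ring.
    by rewrite /cyc_next /cyc_prev; case: ifP; case: ifP; lia.
  by rewrite /cyc_prev; case: ifP; lia.
rewrite big_distrr /=; apply: eq_big_nat => i i2.
rewrite /ext_entry ifT ?ifF; [|lia|lia].
by rewrite mulrCA (_ : (k + i - 1 - k + 1 = i)%N) //; lia.
Qed.

Lemma ext_col_tail (m : nat) (z : nat -> R) : (1 < m <= n)%N ->
  \sum_(1 <= p < N.+1) z p * ext_entry p (k + m - 1)
    = z k * a 1 m + \sum_(2 <= i < n.+1) z (k + i - 1)%N * a i m.
Proof.
move=> mn; rewrite sum_split_block; congr (_ + _).
  rewrite -(@sum_nat_pick _ 1 k.+1 k (fun p => z p * a 1 m)); last lia.
  apply: eq_big_nat => p pk; rewrite /ext_entry ifF; last lia.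
  case: eqP => [->|pk']; last by rewrite ifF ?mulr0 ?mul0r //; lia.
  by rewrite leqnn mul1r; congr (_ * a _ _); lia.
apply: eq_big_nat => i i2; rewrite /ext_entry ifF ?ifT; [|lia|lia].
by congr (_ * a _ _); lia.
Qed.

(** * Right and left eigenvectors of the extension *)

Variables (u v z : nat -> R).
Hypothesis Au : forall p, (0 < p <= n)%N ->
  \sum_(1 <= q < n.+1) a p q * u q = lam * u p.
Hypothesis vA : forall q, (0 < q <= n)%N ->
  \sum_(1 <= p < n.+1) v p * a p q = lam * v q.
Hypothesis z_tail : forall i, (0 < i <= n)%N -> z (k + i - 1) = v i.
(** The left eigenvector equation in a head column, with the tail sum already replaced by its value
    from [sum_v_col1]. *)
Hypothesis z_head : forall q, (0 < q <= k)%N ->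
  z (cyc_prev q) * cyc_weight (cyc_prev q)
    + (q == s)%:R * (z j * d + (lam - a 1 1) * v 1) = lam * z q.

Definition ext_w (i : nat) : R := if (i <= k - 1)%N then u 1 else u (i - k + 1).

Lemma ext_w_head (i : nat) : (i <= k)%N -> ext_w i = u 1.
Proof.
by move=> ik; rewrite /ext_w; case: ifP => // ik'; congr u; lia.
Qed.

Lemma ext_w_tail (i : nat) : (0 < i)%N -> ext_w (k + i - 1) = u i.
Proof.
move=> i0; have [->|i1] := eqVneq i 1%N; first by apply: ext_w_head; lia.
by rewrite /ext_w ifF; [congr u|]; lia.
Qed.

Lemma head_or_tail (p : nat) : (0 < p <= N)%N ->
  (0 < p <= k)%N \/ exists2 m, (1 < m <= n)%N & p = (k + m - 1)%N.
Proof.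
move=> pN; have [pk|pk] := leqP p k; first by left; lia.
by right; exists (p - k + 1)%N; lia.
Qed.

(** The redirection of d is invisible to w, which equals u 1 at every head position. Rows from k on
    become the rows of A u = lam u. *)
Lemma ext_mul_w : mkmx N ext_entry *m mkcol N ext_w = lam *: mkcol N ext_w.
Proof.
rewrite mul_mkmx_mkcol scale_mkcol; apply/mkcolP => p /head_or_tail [pk|[m mn ->]].
  rewrite ext_row_head // !ext_w_head; [|lia|lia|by rewrite /cyc_next; case: ifP; lia].
  rewrite /cyc_weight -mulrDl subrK; have [pk'|kp] := ltnP p k.
    by rewrite (_ : (p == k) = false) ?mul0r ?addr0 //; lia.
  have -> : p = k by lia.
  rewrite eqxx mul1r -Au; last lia.
  rewrite [RHS]big_ltn; last lia.
  by congr (_ + _); apply: eq_big_nat => i i2; rewrite ext_w_tail //; lia.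
rewrite ext_row_tail // ext_w_head ?ext_w_tail; [|lia|lia].
rewrite -Au; last lia.
rewrite [RHS]big_ltn; last lia.
by congr (_ + _); apply: eq_big_nat => i i2; rewrite ext_w_tail //; lia.
Qed.

(** Column 1 of v^T A = lam v^T with its first term moved to the right. *)
Lemma sum_v_col1 :
  \sum_(2 <= i < n.+1) z (k + i - 1)%N * a i 1 = (lam - a 1 1) * v 1.
Proof.
rewrite mulrBl -vA ?n1 // [in RHS]big_ltn; last lia.
rewrite [v 1%N * _]mulrC addrAC subrr add0r; apply: eq_big_nat => i i2.
by rewrite z_tail //; lia.
Qed.

Lemma ext_z_mul : (mkcol N z)^T *m mkmx N ext_entry = lam *: (mkcol N z)^T.
Proof.
rewrite mul_mkcol_mkmx -linearZ scale_mkcol; congr trmx.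
apply/mkcolP => q /head_or_tail [qk|[m mn ->]].
  by rewrite ext_col_head // sum_v_col1 z_head.
rewrite ext_col_tail // z_tail; last lia.
rewrite -vA; last lia.
rewrite [RHS]big_ltn; last lia.
have -> : z k = v 1%N by rewrite -z_tail ?n1 //; congr z; lia.
congr (_ + _).
by apply: eq_big_nat => i i2; rewrite z_tail //; lia.
Qed.

Lemma ext_colquant : s != cyc_next j ->
  colquant (mkmx N ext_entry) (mkcol N z) j s = d * z j + (lam - a 1 1) * v 1.
Proof.
move=> sj; have sN : (0 < s <= N)%N by lia.
rewrite /colquant ent_mkmx ?ent_mkcol //; [|lia|lia]; congr (_ + _).
  rewrite /ext_entry !ifT; [|lia|lia].
  (* As s is not the successor of j, entry (j, s) is d alone, without a cycle weight. *)
  by rewrite (negPf sj) !eqxx mul0r add0r mul1r mulr1.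
rewrite -sum_v_col1 [RHS]big_add1 /=; apply: eq_big_nat => i i1.
rewrite ent_mkmx ?ent_mkcol; [|lia|lia|lia].
rewrite (_ : (k + i.+1 - 1 = k + i)%N); last lia.
rewrite mulrC /ext_entry ifT ?ifF ?eqxx ?mul1r; [|lia|lia].
by congr (_ * a _ _); lia.
Qed.

(** * Simplicity and algebraic positivity of the extension *)

Hypotheses (lam0 : 0 < lam) (dlam : (j < k)%N -> d < lam).

(* The first k - 1 rows force an eigenvector x for lam to be constant on its
   first k entries; the last n entries then form an eigenvector of
   the original matrix. *)
Lemma ext_eigenvector_head (x : nat -> R) :
  (forall p, (0 < p <= N)%N ->
     \sum_(1 <= q < N.+1) ext_entry p q * x q = lam * x p) ->
  forall p, (0 < p <= k)%N -> x p = x k.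
Proof.
move=> Bx.
have step p : (0 < p < k)%N -> p != j -> x p = x p.+1.
  move=> pk /negPf pj; have := Bx p; rewrite ext_row_head; [|lia].
  rewrite /cyc_weight /cyc_next pj ifT; last lia.
  rewrite ifT; last lia.
  rewrite (_ : (p == k) = false); last lia.
  rewrite !(mulr0, mul0r, subr0, addr0) => H; apply/esym/(mulfI (lt0r_neq0 lam0)).
  by apply: H; lia.
(* [step] is available only away from j, so constancy is first propagated on each side of j. *)
have above p : (j < p <= k)%N -> x p = x k.
  move=> pk; have [t pt] : exists t, (p + t)%N = k by exists (k - p)%N; lia.
  elim: t p pk pt => [|t IH] p pk pt; first by congr x; lia.
  by rewrite step; [apply: IH|..]; lia.
have below p : (0 < p <= j)%N -> x p = x j.
  move=> pk; have [t pt] : exists t, (p + t)%N = j by exists (j - p)%N; lia.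
  elim: t p pk pt => [|t IH] p pk pt; first by congr x; lia.
  by rewrite step; [apply: IH|..]; lia.
have xjk : x j = x k.
  have [jltk|kj] := ltnP j k; last by congr x; lia.
  have := Bx j; rewrite ext_row_head; [|lia].
  rewrite /cyc_weight /cyc_next eqxx jltk.
  rewrite (_ : (j == k) = false); last lia.
  rewrite !(mulr1, mul0r, addr0) (above j.+1); last lia.
  (* Row j reads (lam - d) x_k + d x_s = lam x_j. If s <= j then x_s = x_j and lam - d > 0 is
     cancelled; otherwise x_s = x_k and lam is cancelled. *)
  move=> /(_ ltac:(lia)); have [sj|js] := leqP s j.
    rewrite (below s); last lia.
    have dl := dlam jltk; move=> H.
    have : (lam - d) * (x k - x j) = 0 by lra.
    by move/eqP; rewrite mulf_eq0 subr_eq0 gt_eqF //= subr_eq0 => /eqP.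
  rewrite (above s); last lia.
  by rewrite -mulrDl subrK; move/(mulfI (lt0r_neq0 lam0)).
move=> p pk; have [pj|jp] := leqP p j; first by rewrite below //; lia.
by apply: above; lia.
Qed.

Hypothesis u0 : forall i, (0 < i <= n)%N -> 0 < u i.
Hypothesis v0 : forall i, (0 < i <= n)%N -> 0 < v i.
Hypothesis z0 : forall q, (0 < q < k)%N -> 0 < z q.
Hypothesis simA : simple_eigenvalue (mkmx n a) lam.

Lemma ext_w_gt0 (i : 'I_N) : 0 < mkcol N ext_w i 0.
Proof.
by rewrite mxE /ext_w; case: ifP => ik; apply: u0; have := ltn_ord i; lia.
Qed.

Lemma ext_z_gt0 (i : 'I_N) : 0 < mkcol N z i 0.
Proof.
rewrite mxE; have [ik|ki] := ltnP i.+1 k; first by apply: z0; lia.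
have iN := ltn_ord i.
have -> : z i.+1 = v (i.+1 - k + 1) by rewrite -z_tail; [congr z|]; lia.
by apply: v0; lia.
Qed.

Lemma ext_simple : simple_eigenvalue (mkmx N ext_entry) lam.
Proof.
have N0 : (0 < N)%N by lia.
have zw := dotmx_gt0 _ _ _ _ N0 ext_w_gt0 ext_z_gt0.
apply/(simple_eigenvalueP _ _ _ _ _ _ ext_mul_w ext_z_mul (lt0r_neq0 zw)).
have AuM : mkmx n a *m mkcol n u = lam *: mkcol n u.
  by rewrite mul_mkmx_mkcol scale_mkcol; apply/mkcolP.
have vAM : (mkcol n v)^T *m mkmx n a = lam *: (mkcol n v)^T.
  by rewrite mul_mkcol_mkmx -linearZ scale_mkcol; congr trmx; apply/mkcolP.
have vu : 0 < ((mkcol n v)^T *m mkcol n u) 0 0.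
  by apply: dotmx_gt0 => // i; rewrite mxE ?u0 ?v0 /=.
have kerA := (simple_eigenvalueP _ _ _ _ _ _ AuM vAM (lt0r_neq0 vu)).1 simA.
move=> X; rewrite -(mkcol_ent _ _ X); set x := fun i => ent X i 1.
rewrite mul_mkmx_mkcol scale_mkcol => /mkcolP Bx.
have xk := ext_eigenvector_head _ Bx.
have [|c] := kerA (mkcol n (fun i => x (k + i - 1)%N)).
  rewrite mul_mkmx_mkcol scale_mkcol; apply/mkcolP => p pn.
  have kp : (0 < k + p - 1 <= N)%N by lia.
  rewrite -(Bx _ kp) big_ltn; last lia.
  have [p1|p1] := eqVneq p 1%N; last first.
    rewrite ext_row_tail; last lia.
    by rewrite (xk s) // addnK.
  rewrite p1 addnK ext_row_head; last lia.
  rewrite (xk s) // (xk (cyc_next k)); last by rewrite /cyc_next ltnn.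
  by rewrite -mulrDl /cyc_weight subrK ltnn eqxx mul1r.
(* The scalar found on the tail also fits the head, because position k carries index 1. *)
rewrite scale_mkcol => /mkcolP xu; exists c.
rewrite scale_mkcol; apply/mkcolP => p /head_or_tail [pk|[m mn ->]].
  rewrite xk // ext_w_head; last lia.
  by rewrite -xu // addnK.
by rewrite ext_w_tail ?xu //; lia.
Qed.

Lemma ext_alg_positive : alg_positive (mkmx N ext_entry).
Proof.
exact: alg_positive_simple ext_simple ext_mul_w ext_z_mul ext_w_gt0 ext_z_gt0.
Qed.

End Extension.

(** * The three families as cycle extensions *)

Section Cases.
Variables (R : realType) (n k : nat) (A : 'M[R]_n) (lam : R).
Local Notation a := (ent A).

Local Ltac case_bool b :=
  lazymatch b with
  | context [if _ then _ else _] => fail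
  | _ => case: (boolP b) => ?; try (exfalso; lia)
  end.

Local Ltac split_ifs := repeat (match goal with
  | |- context [if ?b then _ else _] => case_bool b
  | |- context [nat_of_bool ?b] => case_bool b
  end; rewrite /=).

Lemma B1_ext (j : nat) : (1 <= j <= k)%N ->
  B1 k A lam j = mkmx _ (ext_entry R k a lam k j 0).
Proof.
move=> jk; apply: mkmxP => p q pN qN.
rewrite /B1f /ext_entry /blockA /superdiag /cyc_weight /cyc_next.
by split_ifs; ring.
Qed.

(** As s != j + 1, the parts e lam and (1 - e) lam of the weight of row j fall in different
    columns. *)
Lemma B2_ext (e : R) (j s : nat) :
  (1 <= j <= k - 1)%N -> (1 <= s <= k)%N -> s != j.+1 ->
  B2 k A lam e j s = mkmx _ (ext_entry R k a lam j s ((1 - e) * lam)).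
Proof.
move=> jk sk sj; apply: mkmxP => p q pN qN.
rewrite /B2f /ext_entry /blockA /superdiag /cyc_weight /cyc_next.
by split_ifs; ring.
Qed.

Lemma B3_ext (e : R) (s : nat) : (2 <= s <= k)%N ->
  B3 k A lam e s = mkmx _ (ext_entry R k a lam k s ((1 - e) * a 1 1)).
Proof.
move=> sk; apply: mkmxP => p q pN qN.
rewrite /B3f /ext_entry /blockA /superdiag /cyc_weight /cyc_next.
by split_ifs; ring.
Qed.

Variables (u v : 'cV[R]_n).
Hypotheses (n1 : (0 < n)%N) (k1 : (0 < k)%N).
Local Notation v1 := (ent v 1 1).
Hypotheses (a11 : 0 < a 1 1) (lam0 : 0 < lam) (simA : simple_eigenvalue A lam).
Hypotheses (Au : A *m u = lam *: u) (vA : v^T *m A = lam *: v^T).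
Hypotheses (u0 : forall i, 0 < u i 0) (v0 : forall i, 0 < v i 0).

Lemma ent_gt0 (x : 'cV[R]_n) (i : nat) :
  (forall i, 0 < x i 0) -> (0 < i <= n)%N -> 0 < ent x i 1.
Proof.
case: i => // i x0 i_n; have := x0 (Ordinal i_n).
by rewrite -{1}(mkcol_ent _ _ x) mxE.
Qed.

(** Each family now only has to supply the head profile h of its left eigenvector and check k scalar
    equations; [h k = v1] lets h and the tail overlap at position k. *)
Lemma ext_eigen (j s : nat) (d : R) (z h : nat -> R)
    (B := mkmx (k + n - 1) (ext_entry R k a lam j s d))
    (zz := mkcol (k + n - 1) z) :
  (0 < j <= k)%N -> (0 < s <= k)%N -> ((j < k)%N -> d < lam) ->
  (forall q, z q = if (q < k)%N then h q else ent v (q - k + 1) 1) ->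
  h k = v1 -> (forall q, (0 < q < k)%N -> 0 < h q) ->
  (forall q, (0 < q <= k)%N ->
     h (cyc_prev k q) * cyc_weight R k a lam j d (cyc_prev k q)
       + (q == s)%:R * (h j * d + (lam - a 1 1) * v1) = lam * h q) ->
  [/\ simple_eigenvalue B lam, B *m wvec k u = lam *: wvec k u,
      zz^T *m B = lam *: zz^T, alg_positive B
    & s != cyc_next k j ->
      colquant B zz j s = d * h j + (lam - a 1 1) * v1].
Proof.
move=> jk sk dlam zE hk h0 zh.
pose uf i := ent u i 1; pose vf i := ent v i 1.
have zhE q : (q <= k)%N -> z q = h q.
  move=> qk; rewrite zE; case: ltnP => // kq.
  by rewrite (_ : q = k) ?addKn ?hk ?subnn //; lia.
have Auf p : (0 < p <= n)%N ->
    \sum_(1 <= q < n.+1) a p q * ent u q 1 = lam * ent u p 1.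
  move: p; apply/mkcolP; rewrite -scale_mkcol -mul_mkmx_mkcol.
  by rewrite mkmx_ent mkcol_ent.
have vAf q : (0 < q <= n)%N ->
    \sum_(1 <= p < n.+1) ent v p 1 * a p q = lam * ent v q 1.
  move: q; apply/mkcolP; apply: trmx_inj.
  by rewrite -scale_mkcol -mul_mkcol_mkmx mkmx_ent mkcol_ent vA linearZ.
have u0f i (i_n : (0 < i <= n)%N) := ent_gt0 u i u0 i_n.
have v0f i (i_n : (0 < i <= n)%N) := ent_gt0 v i v0 i_n.
have zt i : (0 < i <= n)%N -> z (k + i - 1)%N = ent v i 1.
  move=> i_n; have [->|i1] := eqVneq i 1%N; first by rewrite addnK zhE.
  by rewrite zE ifF; [congr (ent v _ 1)|]; lia.
have z0 q : (0 < q < k)%N -> 0 < z q by move=> qk; rewrite zhE ?h0 //; lia.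
have zhf q : (0 < q <= k)%N ->
    z (cyc_prev k q) * cyc_weight R k a lam j d (cyc_prev k q)
      + (q == s)%:R * (z j * d + (lam - a 1 1) * v1) = lam * z q.
  move=> qk; rewrite !zhE ?zh //; [lia|lia|].
  by rewrite /cyc_prev; case: ifP; lia.
have simA' : simple_eigenvalue (mkmx n a) lam by rewrite mkmx_ent.
split.
- by apply: (ext_simple _ _ _ _ _ _ _ _ n1 k1 jk sk uf vf z).
- by apply: (ext_mul_w _ _ _ _ _ _ _ _ n1 k1 jk sk uf).
- by apply: (ext_z_mul _ _ _ _ _ _ _ _ n1 k1 jk sk vf).
- by apply: (ext_alg_positive _ _ _ _ _ _ _ _ n1 k1 jk sk uf vf z).
- move=> sj; rewrite -(zhE j); last lia.
  by apply: (ext_colquant _ _ _ _ _ _ _ _ n1 k1 jk sk vf).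
Qed.


(** Around the cycle, the edge from k to 1 gives z_1 = a11 v1 / lam when j > 1, and the edges of
    weight lam carry this value on. At column j the tail adds (lam - a11) v1, which raises it to
    v1. *)
Lemma B1_eigen (j : nat) : (1 <= j <= k)%N ->
  simple_eigenvalue (B1 k A lam j) lam
  /\ B1 k A lam j *m wvec k u = lam *: wvec k u
  /\ (z1 k A lam v j)^T *m B1 k A lam j = lam *: (z1 k A lam v j)^T
  /\ alg_positive (B1 k A lam j).
Proof.
move=> jk; have v1_gt0 : 0 < v1 by apply: ent_gt0.
pose h q := if (q <= j - 1)%N then a 1 1 * v1 / lam else v1.
pose z q := if (q < k)%N then h q else ent v (q - k + 1) 1.
have -> : z1 k A lam v j = mkcol _ z.
  by apply/mkcolP => q qN; rewrite /z /h; clear - n1 k1 jk qN; split_ifs.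
rewrite B1_ext //.
have [] // := @ext_eigen k j 0 z h _ jk (fun _ => lam0) (fun q => erefl).
- by lia.
- by rewrite /h ifF //; lia.
- by move=> q qk; rewrite /h; case: ifP; rewrite // divr_gt0 ?mulr_gt0.
move=> q qk; rewrite /h /cyc_prev /cyc_weight.
have ln0 := lt0r_neq0 lam0.
by clear - ln0 jk qk; split_ifs; field.
Qed.

(** Along the cycle, z is multiplied by e on passing from j to j + 1, and jumps at s, where the
    redirected weight and the first column of A arrive. *)
Lemma B2_eigen (e : R) (j s : nat) : 0 < e < 1 ->
  (1 <= j <= k - 1)%N -> (1 <= s <= k)%N -> s != j.+1 ->
  [/\ simple_eigenvalue (B2 k A lam e j s) lam,
      B2 k A lam e j s *m wvec k u = lam *: wvec k u,
      (z2 k A lam v e j s)^T *m B2 k A lam e j s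
        = lam *: (z2 k A lam v e j s)^T,
      alg_positive (B2 k A lam e j s)
    & colquant (B2 k A lam e j s) (z2 k A lam v e j s) j s
        = (if (s <= j)%N then (lam / e - a 1 1) * v1
           else (lam - e * a 1 1) * v1)].
Proof.
move=> /andP[e0 e1] jk sk sj; have v1_gt0 : 0 < v1 by apply: ent_gt0.
have [ln0 en0] := (lt0r_neq0 lam0, lt0r_neq0 e0).
pose h q := if (s <= j)%N then
    (if (q <= s - 1)%N then a 1 1 * v1 / lam
     else if (q <= j)%N then v1 / e else v1)
  else
    (if (q <= j)%N then a 1 1 * v1 / lam
     else if (q <= s - 1)%N then e * a 1 1 * v1 / lam else v1).
pose z q := if (q < k)%N then h q else ent v (q - k + 1) 1.
have zE : z2 k A lam v e j s = mkcol _ z.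
  by apply/mkcolP => q qN; rewrite /z /h; clear - n1 k1 jk sk sj qN; split_ifs.
rewrite zE B2_ext //.
have jk' : (0 < j <= k)%N by lia.
have dlam : (j < k)%N -> (1 - e) * lam < lam.
  by rewrite gtr_pMl // gtrBl.
have [|q qk|q qk|? ? ? ? cq] := @ext_eigen j s _ z h jk' sk dlam (fun q => erefl).
- by clear - jk sk; rewrite /h; split_ifs.
- by rewrite /h; do 3?case: ifP => _; rewrite ?divr_gt0 ?mulr_gt0.
(* Column 1 is treated apart, as its cyclic predecessor is k. *)
- rewrite /cyc_prev /cyc_weight /h; have [->|q1] := eqVneq q 1%N.
    by clear - ln0 en0 k1 jk sk sj; split_ifs; field; rewrite ?ln0 ?en0.
  by clear - ln0 en0 k1 jk sk sj qk q1; split_ifs; field; rewrite ?ln0 ?en0.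
split=> //; rewrite cq /h; last by rewrite /cyc_next ifT //; lia.
by clear - ln0 en0 jk sk sj; split_ifs; field; rewrite ?ln0 ?en0.
Qed.

Lemma B3_eigen (e : R) (s : nat) : 0 < e < 1 -> (2 <= s <= k)%N ->
  [/\ simple_eigenvalue (B3 k A lam e s) lam,
      B3 k A lam e s *m wvec k u = lam *: wvec k u,
      (z3 k A lam v e s)^T *m B3 k A lam e s = lam *: (z3 k A lam v e s)^T,
      alg_positive (B3 k A lam e s)
    & colquant (B3 k A lam e s) (z3 k A lam v e s) k s
        = (lam - e * a 1 1) * v1].
Proof.
move=> /andP[e0 e1] sk; have v1_gt0 : 0 < v1 by apply: ent_gt0.
have ln0 := lt0r_neq0 lam0.
pose h q := if (q <= s - 1)%N then e * a 1 1 * v1 / lam else v1.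
pose z q := if (q < k)%N then h q else ent v (q - k + 1) 1.
have zE : z3 k A lam v e s = mkcol _ z.
  by apply/mkcolP => q qN; rewrite /z /h; clear - n1 k1 sk qN; split_ifs.
rewrite zE B3_ext //.
have kk : (0 < k <= k)%N by lia.
have sk' : (0 < s <= k)%N by lia.
have dlam : (k < k)%N -> (1 - e) * a 1 1 < lam by lia.
have [|q qk|q qk|? ? ? ? cq] := @ext_eigen k s _ z h kk sk' dlam (fun q => erefl).
- by clear - sk; rewrite /h; split_ifs.
- by rewrite /h; case: ifP => _; rewrite ?divr_gt0 ?mulr_gt0.
- by rewrite /h /cyc_prev /cyc_weight; clear - ln0 sk qk; split_ifs; field.
split=> //; rewrite cq /h; last by rewrite /cyc_next ltnn; lia.
by clear - sk; split_ifs; ring.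
Qed.

End Cases.


(** * Assembly of the three families, and one epsilon for all positivity claims *)

Theorem theorem2p4 (R : realType) (eps : R) (n k : nat) (A : 'M[R]_n)
    (lam : R) (u v : 'cV[R]_n) :
  0 < eps < 1 -> (1 <= n)%N -> (1 <= k)%N ->
  0 < ent A 1 1 ->
  0 < lam -> simple_eigenvalue A lam ->
  A *m u = lam *: u -> v^T *m A = lam *: v^T ->
  (forall i, 0 < u i 0) -> (forall i, 0 < v i 0) ->
  (* Part 1 *)
  (forall j : nat, (1 <= j <= k)%N ->
     simple_eigenvalue (B1 k A lam j) lam
     /\ B1 k A lam j *m wvec k u = lam *: wvec k u
     /\ (z1 k A lam v j)^T *m B1 k A lam j = lam *: (z1 k A lam v j)^T
     /\ alg_positive (B1 k A lam j))
  /\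
  (* Part 2 *)
  (forall j s : nat, (1 <= j <= k - 1)%N -> (1 <= s <= k)%N -> s != j.+1 ->
     simple_eigenvalue (B2 k A lam eps j s) lam
     /\ B2 k A lam eps j s *m wvec k u = lam *: wvec k u
     /\ (z2 k A lam v eps j s)^T *m B2 k A lam eps j s
          = lam *: (z2 k A lam v eps j s)^T
     /\ alg_positive (B2 k A lam eps j s)
     /\ colquant (B2 k A lam eps j s) (z2 k A lam v eps j s) j s
          = (if (s <= j)%N then (lam / eps - ent A 1 1) * ent v 1 1
             else (lam - eps * ent A 1 1) * ent v 1 1)
     /\ (exists e : R, 0 < e < 1 /\
           0 < colquant (B2 k A lam e j s) (z2 k A lam v e j s) j s))
  /\
  (* Part 3 *)
  (forall s : nat, (2 <= s <= k)%N ->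
     simple_eigenvalue (B3 k A lam eps s) lam
     /\ B3 k A lam eps s *m wvec k u = lam *: wvec k u
     /\ (z3 k A lam v eps s)^T *m B3 k A lam eps s
          = lam *: (z3 k A lam v eps s)^T
     /\ alg_positive (B3 k A lam eps s)
     /\ colquant (B3 k A lam eps s) (z3 k A lam v eps s) k s
          = (lam - eps * ent A 1 1) * ent v 1 1
     /\ (exists e : R, 0 < e < 1 /\
           0 < colquant (B3 k A lam e s) (z3 k A lam v e s) k s)).
Proof.
move=> e01 n1 k1 a11 lam0 simA Au vA u0 v0.
have v1_gt0 : 0 < ent v 1 1 by apply: ent_gt0.
have s0 : 0 < lam + ent A 1 1 by rewrite addr_gt0.
(* Chosen so that lam / e - a11 = lam and lam - e a11 = e lam; the same value serves both cases of
   the second family and the third family. *)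
pose e := lam / (lam + ent A 1 1).
have e01' : 0 < e < 1.
  by rewrite divr_gt0 //= ltr_pdivrMr // mul1r ltrDl.
have lam_e : lam / e - ent A 1 1 = lam.
  by rewrite /e invf_div mulrCA divff ?gt_eqF // mulr1 addrK.
have e_a11 : 0 < lam - e * ent A 1 1.
  have -> : lam - e * ent A 1 1 = e * lam.
    by rewrite /e; field; rewrite gt_eqF.
  by rewrite mulr_gt0 ?divr_gt0.
split; [|split].
- exact: B1_eigen.
- move=> j s jk sk sj.
  have [? ? ? ? ?] :=
    B2_eigen _ _ _ _ _ u v n1 k1 a11 lam0 simA Au vA u0 v0 eps j s e01 jk sk sj.
  do 5 split=> //; exists e; split=> //.
  have [_ _ _ _ ->] :=
    B2_eigen _ _ _ _ _ u v n1 k1 a11 lam0 simA Au vA u0 v0 e j s e01' jk sk sj.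
  by case: ifP => _; rewrite mulr_gt0 // lam_e.
- move=> s sk.
  have [? ? ? ? ?] :=
    B3_eigen _ _ _ _ _ u v n1 k1 a11 lam0 simA Au vA u0 v0 eps s e01 sk.
  do 5 split=> //; exists e; split=> //.
  have [_ _ _ _ ->] :=
    B3_eigen _ _ _ _ _ u v n1 k1 a11 lam0 simA Au vA u0 v0 e s e01' sk.
  by rewrite mulr_gt0.
Qed.
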